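(* For $n\ge0$ and $0\le k\le\lfloor n/2\rfloor$, $$E_{n,k}(f,h\,|\,t,\alpha)=\sum_{\sigma\in\mathcal{A}^1_{n+1,\mathrm{des}=k}}f^{\mathrm{lmaxpk}(\sigma)-1}h^{\mathrm{D}(\sigma)}t^{\mathrm{lmaxda}(\sigma)}\alpha^{\mathrm{lmax}(\sigma)-1}.$$
   Context: $\mathfrak{S}_N$ is the set of permutations $\sigma=\sigma_1\cdots\sigma_N$ of $[N]$. With the convention $\sigma_0=\sigma_{N+1}=0$, a letter $\sigma_i$ ($i\in[N]$) is a valley if $\sigma_{i-1}>\sigma_i<\sigma_{i+1}$, a peak if $\sigma_{i-1}<\sigma_i>\sigma_{i+1}$, a double ascent if $\sigma_{i-1}<\sigma_i<\sigma_{i+1}$, a double descent if $\sigma_{i-1}>\sigma_i>\sigma_{i+1}$. $\mathrm{Val}(\sigma)$, $\mathrm{Pk}(\sigma)$ are the sets of letters that are valleys, peaks; $\mathrm{dd}(\sigma)$ is the number of double descents; $\mathrm{des}(\sigma)=\#\{1\le i\le N-1:\sigma_i>\sigma_{i+1}\}$. A letter is a left-to-right (resp. right-to-left) maximum if it is larger than all letters to its left (resp. right); $\mathrm{lmax},\mathrm{rmax}$ count these. $\mathrm{lmaxpk}$, $\mathrm{lmaxda}$ count left-to-right maxima that are peaks, resp. double ascents; $\mathrm{rmaxpk}$ counts right-to-left maxima that are peaks. For $\sigma\in\mathfrak{S}_N$, $\mathrm{D}(\sigma)=\sum_{i\in\mathrm{Pk}(\sigma)\setminus\{N\}}i-\sum_{j\in\mathrm{Val}(\sigma)}j$.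 $E_{n,k}(f,h\,|\,t,\alpha)$ is the polynomial (it is known to have nonnegative integer coefficients) defined by $$\sum_{\sigma\in\mathfrak{S}_{n+1},\ \mathrm{dd}(\sigma)=0,\ \mathrm{des}(\sigma)=k}f^{\mathrm{lmaxpk}(\sigma)+\mathrm{rmaxpk}(\sigma)-2}h^{\mathrm{D}(\sigma)}t^{\mathrm{lmaxda}(\sigma)}\alpha^{\mathrm{lmax}(\sigma)+\mathrm{rmax}(\sigma)-2}=2^k\,E_{n,k}(f,h\,|\,t,\alpha).$$ For $x=\sigma_i$, the $x$-factorization of $\sigma$ is $\sigma=u\,\lambda(x)\,x\,\rho(x)\,v$, where $\lambda(x)$ (resp. $\rho(x)$) is the maximal (possibly empty) contiguous factor immediately to the left (resp. right) of $x$ all of whose letters are larger than $x$. A permutation $\sigma\in\mathfrak{S}_N$ is an André permutation of the first kind if it has no double descents and, for every letter $x$: $\lambda(x)=\emptyset$ if $\rho(x)=\emptyset$, and $\max\lambda(x)<\max\rho(x)$ if both $\lambda(x)$ and $\rho(x)$ are nonempty. $\mathcal{A}^1_{N,\mathrm{des}=k}$ is the set of André permutations of the first kind in $\mathfrak{S}_N$ with $\mathrm{des}(\sigma)=k$. *)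

(* Defs.v *)
From mathcomp Require Import all_boot all_order all_algebra.
From mathcomp Require Import all_fingroup zify.
From mathcomp Require Export mpoly.

Set Implicit Arguments.
Unset Strict Implicit.
Unset Printing Implicit Defensive.

Import GRing.Theory.

(* A permutation of [N] is s : 'S_N, read as the word of the 1-based letters
   (s i).+1.  Statistics are defined on words. *)
Definition word N (s : 'S_N) : seq nat := [seq (s i).+1 | i <- enum 'I_N].

Section WordStatistics.
Variable w : seq nat.

(* letter i = sigma_i, with positions counted from 1; out-of-range positions
   give sigma_0 = sigma_(N+1) = 0. *)
Definition letter (i : nat) : nat := nth 0 (0 :: w) i.

Definition positions : seq nat := iota 1 (size w).

Definition valley (i : nat) : bool :=
  (letter i < letter i.-1) && (letter i < letter i.+1).
Definition peak (i : nat) : bool :=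
  (letter i.-1 < letter i) && (letter i.+1 < letter i).
Definition dascent (i : nat) : bool := letter i.-1 < letter i < letter i.+1.
Definition ddescent (i : nat) : bool := letter i.+1 < letter i < letter i.-1.

Definition Val : seq nat := [seq letter i | i <- positions & valley i].
Definition Pk : seq nat := [seq letter i | i <- positions & peak i].

Definition dd : nat := count ddescent positions.
Definition des : nat :=
  count (fun i => letter i.+1 < letter i) (iota 1 (size w).-1).

Definition is_lmax (i : nat) : bool := all (ltn^~ (letter i)) (take i.-1 w).
Definition is_rmax (i : nat) : bool := all (ltn^~ (letter i)) (drop i w).

Definition lmax : nat := count is_lmax positions.
Definition rmax : nat := count is_rmax positions.
Definition lmaxpk : nat := count (predI is_lmax peak) positions.
Definition lmaxda : nat := count (predI is_lmax dascent) positions.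
Definition rmaxpk : nat := count (predI is_rmax peak) positions.

(* The subtraction is not truncated on permutations: see sum_Val_le_Pk. *)
Definition Dstat : nat :=
  \sum_(i <- Pk | i != size w) i - \sum_(j <- Val) j.

(* longest prefix of r all of whose letters are larger than x *)
Definition prefix_above (x : nat) (r : seq nat) : seq nat :=
  take (find (geq x) r) r.

Definition lambda (x : nat) : seq nat :=
  rev (prefix_above x (rev (take (index x w) w))).
Definition rho (x : nat) : seq nat := prefix_above x (drop (index x w).+1 w).

Definition andre1 : bool :=
  (dd == 0) &&
  all (fun x =>
         ((rho x == [::]) ==> (lambda x == [::])) &&
         ((lambda x != [::]) && (rho x != [::]) ==>
            (\max_(y <- lambda x) y < \max_(y <- rho x) y))) w.

End WordStatistics.

Lemma size_word N (s : 'S_N) : size (word s) = N.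
Proof. by rewrite size_map size_enum_ord. Qed.

Lemma perm_word N (s : 'S_N) : perm_eq (word s) (iota 1 N).
Proof.
have uw : uniq (word s).
  by rewrite map_inj_uniq ?enum_uniq // => i j [] /ord_inj/perm_inj.
have [] // := uniq_min_size uw (s2 := iota 1 N) _ _.
- by move=> _ /mapP[i _ ->]; rewrite mem_iota; have := ltn_ord (s i); lia.
- by rewrite size_iota size_word.
by move=> _ eqw; apply: uniq_perm => //; apply: iota_uniq.
Qed.

Lemma letter_inj N (s : 'S_N) i j : 0 < i <= N -> 0 < j <= N.+1 ->
  letter (word s) i = letter (word s) j -> i = j.
Proof.
pose w := rcons (word s) 0.
have uw : uniq w.
  by rewrite rcons_uniq (perm_uniq (perm_word s)) iota_uniq
    (perm_mem (perm_word s)) mem_iota.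
have lw m : 0 < m -> letter (word s) m = nth 0 w m.-1.
  case: m => // m _; rewrite /letter /= nth_rcons.
  by case: ltnP => // ?; rewrite if_same nth_default.
have sw : size w = N.+1 by rewrite size_rcons size_word.
move=> hi hj; rewrite !lw; try lia.
by move/eqP; rewrite nth_uniq ?sw //; lia.
Qed.

Lemma letter_gt0 N (s : 'S_N) i : 0 < i <= N -> 0 < letter (word s) i.
Proof.
case: i => // i hi; have := mem_nth 0 (s := word s) (n := i).
by rewrite size_word (perm_mem (perm_word s)) mem_iota /letter /=; lia.
Qed.

Lemma sum_Val_le_Pk N (s : 'S_N) :
  \sum_(j <- Val (word s)) j <= \sum_(i <- Pk (word s) | i != N) i.
Proof.
set w := word s; have sw : size w = N := size_word s.
pose l := letter w.
have neq m : 0 < m <= N -> l m != l m.+1.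
  by move=> mN; apply/eqP => /letter_inj; lia.
have key m : m <= N -> forall j, j <= m ->
    \sum_(1 <= i < m.+1 | valley w i) l i + l j <=
    \sum_(1 <= i < m.+1 | peak w i) l i + (if l m < l m.+1 then l m else 0).
  elim: m => [|m IH] mN j; first by case: j => //; rewrite !big_geq.
  have IHm := IH (ltnW mN).
  rewrite !(big_mkcond (valley w)) !(big_mkcond (peak w)) /=.
  rewrite ![\sum_(1 <= i < m.+2) _]big_nat_recr //= -!big_mkcond /=.
  have hv : valley w m.+1 = (l m.+1 < l m) && (l m.+1 < l m.+2) by [].
  have hp : peak w m.+1 = (l m < l m.+1) && (l m.+2 < l m.+1) by [].
  rewrite hv hp; have := neq m.+1 mN.
  have : l m.+1 != l m.
    case: (m) mN => [|m' mN]; last by rewrite eq_sym neq //; lia.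
    by move=> N0; rewrite -lt0n letter_gt0.
  rewrite leq_eqVlt => n1 n2 /orP[/eqP-> | jm].
    have := IHm m (leqnn m); move: n1 n2.
    by case: (ltngtP (l m) (l m.+1)); case: (ltngtP (l m.+1) (l m.+2)) => /= *; lia.
  have := IHm j jm; move: n1 n2.
  by case: (ltngtP (l m) (l m.+1)); case: (ltngtP (l m.+1) (l m.+2)) => /= *; lia.
have PkE : \sum_(i <- Pk w) i = \sum_(1 <= i < N.+1 | peak w i) l i.
  by rewrite big_map big_filter /positions sw /index_iota subn1.
have [j jN lj] : exists2 j, j <= N & l j = N.
  case: (posnP N) => [N0|N0]; first by exists 0; rewrite // N0.
  have wN : N \in w by rewrite (perm_mem (perm_word s)) mem_iota; lia.
  exists (index N w).+1; last by rewrite /l /letter /= nth_index.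
  by move: wN; rewrite -index_mem sw.
have := key N (leqnn N) j jN; rewrite -PkE {}lj.
have -> : (if l N < l N.+1 then l N else 0) = 0.
  by rewrite /l {2}/letter /= nth_default ?sw.
have -> : \sum_(j <- Val w) j = \sum_(1 <= i < N.+1 | valley w i) l i.
  by rewrite big_map big_filter /positions sw /index_iota subn1.
have -> : \sum_(i <- Pk w) i =
  \sum_(i <- Pk w | i != N) i + \sum_(i <- Pk w | ~~ (i != N)) i.
  by rewrite (bigID (fun i => i != N)).
suff : \sum_(i <- Pk w | ~~ (i != N)) i <= N by lia.
have uP : uniq (Pk w).
  rewrite map_inj_in_uniq ?filter_uniq ?iota_uniq // => x y.
  rewrite !mem_filter !mem_iota sw => /andP[_ hx] /andP[_ hy] /letter_inj.
  by apply; lia.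
under eq_bigl => i do rewrite negbK.
have [NP|NP] := boolP (N \in Pk w).
  by rewrite -big_filter filter_pred1_uniq // big_seq1.
by rewrite big_seq_cond big_pred0 // => i; apply: contraNF NP => /andP[iP /eqP<-].
Qed.

Local Open Scope ring_scope.

Definition f : {mpoly rat[4]} := 'X_(@Ordinal 4 0 isT).
Definition h : {mpoly rat[4]} := 'X_(@Ordinal 4 1 isT).
Definition t : {mpoly rat[4]} := 'X_(@Ordinal 4 2 isT).
Definition alpha : {mpoly rat[4]} := 'X_(@Ordinal 4 3 isT).

(* Divided by 2 ^ k in rational coefficients, so that the defining equation
   2 ^ k E = (sum) has exactly one solution without presupposing that the
   quotient is integral.  Truncated subtraction is harmless in the exponents,
   since the letter N is a peak and a maximum from both sides. *)
Definition E (n k : nat) : {mpoly rat[4]} :=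
  (2 ^- k) *:
  \sum_(s : 'S_n.+1 | (dd (word s) == 0%N) && (des (word s) == k))
    (f ^+ (lmaxpk (word s) + rmaxpk (word s) - 2) * h ^+ Dstat (word s)
     * t ^+ lmaxda (word s) * alpha ^+ (lmax (word s) + rmax (word s) - 2)).

(* Main.v *)
Require Import Defs.
From mathcomp Require Import all_boot all_order all_algebra.
From mathcomp Require Import all_fingroup.
From mathcomp Require Import zify ring.

Set Implicit Arguments.
Unset Strict Implicit.
Unset Printing Implicit Defensive.

Import GRing.Theory.

(** Build a permutation of [N] by inserting its letters in decreasing order
    N, N-1, ..., 1.  At each stage the letters present form a row of blocks,
    the maximal factors of the final word made of letters that are present.
    A new letter x goes into a gap of the row and is glued to neither, the
    right, the left or both of the adjacent blocks; it is then, for ever, a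
    peak, a double ascent, a double descent or a valley.  It is a left-to-right
    (right-to-left) maximum when nothing stands on its left (right).  Hence the
    weight of a permutation is a product of weights of insertions
    ([state_weight_glue]).  In the absence of double descents the left-to-right
    maxima are peaks or double ascents and the right-to-left maxima are peaks,
    so both sides of the theorem are sums of q ^ #(counted peak maxima) times
    T ^ lmaxda times h ^ D, with q = f alpha and T = t alpha.

    Two-sided sum.  With c + 1 blocks there are c + 2 gaps, the first and the
    last of which make a new peak x a maximum: peaks have total weight c + 2q,
    double ascents c + T, valleys c.  These depend on c alone, so the sum
    satisfies the recurrence [value_count] ([count_step]).

    One-sided sum.  The condition of Andre says that a valley may join two
    adjacent blocks only if the maximum of the left one is smaller.  What
    happens later depends only on the list of the maxima of the blocks
    ([value_maxima], [maxima_step]): a peak inserts a new least element in the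
    list, a valley deletes an element at an ascent.  The list must end with N,
    for otherwise N can never become last ([value_maxima_last]).  Now sum over
    all orders of a given set M of c maxima standing before N, each order with
    weight q ^ lmax, which is the weight with which inserting the elements of M
    in decreasing order creates it ([perm_sum]).  Insertion of a new minimum
    preserves this family by definition.  Deletion at ascents preserves it too:
    an order of M minus one element v arises from as many positions of v as
    there are elements larger than v in M and N together, one of which makes v a
    maximum.  Summed over v this gives (c - 1 + q) + ... + (1 + q) + q, which is
    half of c (c - 1 + 2q) ([perm_sum_del_sum]).  If valleys have weight 2 in
    this process, the weighted sum is therefore
    (0 + 2q) (1 + 2q) ... (c - 1 + 2q) times the value of the two-sided
    recurrence at c ([perm_sum_value_maxima]).  At c = 0 the two sums agree, up
    to the factor q with which N itself is a right-to-left maximum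
    ([sum_two_sided_one_sided]).

    A polynomial variable attached to the valleys separates the values of k,
    since des counts the valleys when there are no double descents; the factors
    2 attached to the valleys are the 2 ^ k in the definition of E. *)

(** * Orders of a set and deletion at ascents *)

Section Values.
Local Open Scope ring_scope.
Variable R : comNzRingType.

Fixpoint ins (x : nat) (s : seq nat) : seq (seq nat) :=
  if s is y :: s' then (x :: s) :: [seq y :: u | u <- ins x s'] else [:: [:: x]].

Definition ins_tail (x : nat) (s : seq nat) : seq (seq nat) :=
  if s is y :: s' then [seq y :: u | u <- ins x s'] else [::].

Lemma insE x s : ins x s = (x :: s) :: ins_tail x s.
Proof. by case: s. Qed.

(** The sentinel [N] stands behind the list: it decides whether the last
    position is an ascent. *)
Fixpoint asc_del (N : nat) (s : seq nat) : seq (seq nat) :=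
  if s is y :: s' then
    (if (y < head N s')%N then [:: s'] else [::]) ++ [seq y :: u | u <- asc_del N s']
  else [::].

(** The sum of [F] over the insertions of [x] in [s]; the insertion in front,
    which makes [x] a left-to-right maximum when [x] is the least letter, has
    weight [q]. *)
Definition ins_sum (q : R) (x : nat) (F : seq nat -> R) (s : seq nat) : R :=
  q * F (x :: s) + \sum_(u <- ins_tail x s) F u.

Lemma ins_sum1 x (F : seq nat -> R) s : ins_sum 1 x F s = \sum_(u <- ins x s) F u.
Proof. by rewrite /ins_sum insE big_cons mul1r. Qed.

Definition del_sum N (F : seq nat -> R) (s : seq nat) : R :=
  \sum_(u <- asc_del N s) F u.

Lemma del_sum_cons N F y s :
  del_sum N F (y :: s) =
  (y < head N s)%:R * F s + del_sum N (fun u => F (y :: u)) s.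
Proof.
rewrite /del_sum /= big_cat big_map /=.
by case: ifP => _; rewrite ?big_cons big_nil ?addr0 ?mul1r ?mul0r.
Qed.

Lemma ins_sum_cons q x F y s :
  ins_sum q x F (y :: s) = q * F (x :: y :: s) + ins_sum 1 x (fun u => F (y :: u)) s.
Proof. by rewrite ins_sum1 {1}/ins_sum /= big_map. Qed.

Lemma head_ins_tail N x s u : u \in ins_tail x s -> head N u = head N s.
Proof. by case: s => [|y s] //= /mapP[u' _ ->]. Qed.

(** Inserting a minimum [m] and then deleting at an ascent: either [m] itself is
    deleted, which is possible from every position because [m] lies below its
    successor, or another letter [y] is, and then the two operations commute:
    [m] just after [y] would destroy the ascent, so of the two positions next to
    [y], which deletion merges, only the one before [y] occurs. *)
Lemma ins_sum_del_sum N q m F s : (m < N)%N -> all (ltn m) s ->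
  ins_sum q m (del_sum N F) s =
  ((size s)%:R + q) * F s + del_sum N (ins_sum q m F) s.
Proof.
move=> mN; elim: s q F => [|y s IH] q F /=.
  by move=> _; rewrite /ins_sum /del_sum /= mN big_cons !big_nil; ring.
case/andP=> my /(IH 1) IHs; rewrite ins_sum_cons !del_sum_cons /= my.
have -> : ins_sum 1 m (fun u => del_sum N F (y :: u)) s =
    (y < head N s)%:R * \sum_(u <- ins_tail m s) F u +
    ins_sum 1 m (del_sum N (fun u => F (y :: u))) s.
  rewrite /ins_sum del_sum_cons /= ltnNge (ltnW my) /= mul0r add0r !mul1r.
  under eq_big_seq => u /(head_ins_tail N) hu do rewrite del_sum_cons hu.
  by rewrite big_split /= -mulr_sumr; ring.
rewrite IHs.
have -> : del_sum N (fun u => ins_sum q m F (y :: u)) s =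
    q * del_sum N (fun u => F (m :: y :: u)) s +
    del_sum N (ins_sum 1 m (fun u => F (y :: u))) s.
  rewrite /del_sum mulr_sumr -big_split /=.
  by apply: eq_bigr => u _; rewrite ins_sum_cons.
by rewrite {2}/ins_sum -natr1 mulr1n; ring.
Qed.

(** For increasing [M], the sum of [q ^ lmax(s) * F s] over all orders [s] of [M]:
    the elements are inserted from the largest to the least. *)
Fixpoint perm_sum (q : R) (M : seq nat) (F : seq nat -> R) : R :=
  if M is m :: M' then perm_sum q M' (ins_sum q m F) else F [::].

Lemma perm_ins x s u : u \in ins x s -> perm_eq u (x :: s).
Proof.
elim: s u => [|y s IH] u /=; first by rewrite inE => /eqP->.
rewrite inE => /predU1P[-> // | /mapP[v /IH vP ->]].
by rewrite perm_sym (perm_catCA [:: x] [:: y] s) /= perm_cons perm_sym.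
Qed.

Lemma eq_perm_sum q M F G : (forall s, perm_eq s M -> F s = G s) ->
  perm_sum q M F = perm_sum q M G.
Proof.
elim: M F G => [|m M IH] F G FG /=; first exact: FG.
apply: IH => s sM; have pm : perm_eq (m :: s) (m :: M) by rewrite perm_cons.
rewrite /ins_sum FG //; congr (_ + _); apply: eq_big_seq => u us; apply: FG.
apply: perm_trans pm; apply: perm_ins.
by rewrite insE inE us orbT.
Qed.

Lemma perm_sumD q M F G :
  perm_sum q M (fun s => F s + G s) = perm_sum q M F + perm_sum q M G.
Proof.
elim: M F G => //= m M IH F G; rewrite -IH; apply: eq_perm_sum => s _.
by rewrite /ins_sum big_split /=; ring.
Qed.

Lemma perm_sumZ q M a F : perm_sum q M (fun s => a * F s) = a * perm_sum q M F.
Proof.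
elim: M F => //= m M IH F; rewrite -IH; apply: eq_perm_sum => s _.
by rewrite /ins_sum -mulr_sumr; ring.
Qed.

(** Deletion at ascents maps the family of all weighted orders of [M] to the
    families of the sets [M] minus one element.  The multiplicity of the family
    that misses the [r]-th least element is [size M - r + q], so when all these
    families have the same sum [C] only the total of the multiplicities
    matters. *)
Lemma perm_sum_del_sum N q M F C :
  sorted ltn M -> all (ltn^~ N) M ->
  (forall M', subseq M' M -> (size M').+1 = size M -> perm_sum q M' F = C) ->
  2 * perm_sum q M (del_sum N F) =
  (size M)%:R * ((size M).-1%:R + 2 * q) * C.
Proof.
elim: M F => [|m M IH] F /=.
  by move=> _ _ _; rewrite /del_sum big_nil; ring.
move=> mM /andP[mN MN] FC.
have ltm : all (ltn m) M := order_path_min ltn_trans mM.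
rewrite (@eq_perm_sum _ _ _ (fun s => ((size M)%:R + q) * F s +
                                del_sum N (ins_sum q m F) s)); last first.
  move=> s sM; rewrite ins_sum_del_sum ?(perm_size sM) //.
  by rewrite (perm_all _ sM).
rewrite perm_sumD perm_sumZ mulrDr IH ?(path_sorted mM) //; last first.
  move=> M' sM sz; apply: (FC (m :: M')); first by rewrite /= eqxx.
  by rewrite /= sz.
rewrite (FC M (subseq_cons M m)) //.
case: (M) => [|m' M'] /=; first by ring.
by rewrite -!natr1; ring.
Qed.

End Values.

(** * Value functions of the two insertion processes *)

Section ValueFunctions.
Local Open Scope ring_scope.
Variables (R : comNzRingType) (P Q : nat -> R) (q t : R) (N : nat).

(** The total weight of the ways to insert [x], ..., 1 in a row of [c + 1]
    blocks, ending with one block, when both kinds of maxima count. *)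
Fixpoint value_count (x c : nat) : R :=
  if x is x'.+1 then
    P x * (c%:R + 2 * q) * value_count x' c.+1 + (c%:R + t) * value_count x' c
    + Q x * c%:R * value_count x' c.-1
  else (c == 0%N)%:R.

(** The same total for the one-sided weights under the condition of Andre, for a
    row of blocks whose maxima form the list [r].  The sentinel 0 excludes a
    deletion of the last element, which has no block on its right. *)
Fixpoint value_maxima (x : nat) (r : seq nat) : R :=
  if x is x'.+1 then
    P x * ins_sum q x (value_maxima x') r
    + ((size r).-1%:R + t) * value_maxima x' r
    + 2 * Q x * del_sum 0 (value_maxima x') r
  else (size r == 1%N)%:R.

Lemma ins_rcons x s y :
  ins x (rcons s y) = rcons [seq rcons u y | u <- ins x s] (rcons (rcons s y) x).
Proof.
by elim: s => [|z s IH] //=; rewrite IH map_rcons -!map_comp.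
Qed.

Lemma ins_tail_rcons x s y :
  ins_tail x (rcons s y) =
  rcons [seq rcons u y | u <- ins_tail x s] (rcons (rcons s y) x).
Proof.
by case: s => [|z s] //=; rewrite ins_rcons map_rcons -!map_comp.
Qed.

Lemma asc_del_rcons s y :
  asc_del 0 (rcons s y) = [seq rcons u y | u <- asc_del y s].
Proof.
elim: s => [|z s IH] //=; rewrite IH map_cat -!map_comp.
have -> : head 0%N (rcons s y) = head y s by case: (s).
by case: ifP.
Qed.

Lemma asc_delP r u : u \in asc_del 0 r ->
  exists a y z b, [/\ r = a ++ y :: z :: b, (y < z)%N & u = a ++ z :: b].
Proof.
elim: r u => [|y r IH] u //=; rewrite mem_cat => /orP[].
  case: ifP => // yz; rewrite inE => /eqP->.
  by case: r yz {IH} => [|z b] //= yz; exists [::], y, z, b.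
case/mapP=> v /IH[a [y' [z [b [-> yz ->]]]]] ->.
by exists (y :: a), y', z, b.
Qed.

Lemma ins_tailP x r u : u \in ins_tail x r ->
  exists a y b, r = a ++ y :: b /\ u = a ++ y :: x :: b.
Proof.
case: r => [|y r] //= /mapP[v vr ->] {u}.
elim: r y v vr => [|z r IH] y v /=.
  by rewrite inE => /eqP->; exists [::], y, [::].
rewrite inE => /predU1P[-> | /mapP[w wr ->]]; first by exists [::], y, (z :: r).
have [a [y' [b [er ew]]]] := IH z w wr.
by exists (y :: a), y', b; rewrite /= er ew.
Qed.

(** No deletion at an ascent removes the maximum [N] or the last element, so the
    row never shrinks to a single block. *)
Lemma value_maxima_last x r : (x < N)%N -> all (leq^~ N) r -> N \in r ->
  (last 0 r < N)%N -> value_maxima x r = 0.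
Proof.
elim: x r => [|x IH] r /= xN rN Nr lr.
  case: r rN Nr lr => [|y [|z r]] //= _; rewrite inE => /eqP<-.
  by rewrite ltnn.
have IHx := IH _ (ltnW xN).
have dl : del_sum 0 (value_maxima x) r = 0.
  rewrite /del_sum big1_seq // => u /andP[_ /asc_delP[a [y [z [b [er yz ->]]]]]].
  apply: IHx; move: rN Nr lr; rewrite er !all_cat !mem_cat !last_cat //= !inE.
    by case/and4P=> -> _ ->.
  case/and4P=> _ yN zN _ /or4P[-> // | /eqP yE | -> | ->]; rewrite ?orbT //.
  by move: yz; rewrite -yE ltnNge zN.
have is0 : ins_sum q x.+1 (value_maxima x) r = 0.
  rewrite /ins_sum IHx /= ?(ltnW xN) ?rN ?inE ?Nr ?orbT //; last first.
    by case: (r) Nr lr.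
  rewrite mulr0 add0r big1_seq // => u /andP[_ /ins_tailP[a [y [b [er ->]]]]].
  apply: IHx; move: rN Nr lr; rewrite er !all_cat !mem_cat !last_cat //= !inE.
  - by case/and3P=> -> -> ->; rewrite (ltnW xN).
  - by move=> _ /or3P[] ->; rewrite ?orbT.
  - by case: (b).
by rewrite is0 dl IHx ?mulr0 ?addr0.
Qed.

(** The ratio between the weighted sum of one-sided values over the orders of [c]
    maxima and the two-sided value: the product of the peak weights
    [j + 2 q] of [value_count] below level [c]. *)
Fixpoint perm_factor (c : nat) : R :=
  if c is c'.+1 then perm_factor c' * (c'%:R + 2 * q) else 1.

(** Summed over the weighted orders of [M] before [N], the process under the
    condition of Andre follows the two-sided recurrence: peaks turn the family
    of [M] into that of [x :: M], valleys are handled by [perm_sum_del_sum],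
    and the factors [perm_factor] absorb the difference between the two recurrences. *)
Lemma perm_sum_value_maxima x M : (x < N)%N ->
  sorted ltn M -> all (fun m => x < m < N)%N M ->
  perm_sum q M (fun s => value_maxima x (rcons s N)) =
  perm_factor (size M) * value_count x (size M).
Proof.
elim: x M => [|x IH] M xN sM MN.
  rewrite (@eq_perm_sum _ _ _ _ (fun _ => (size M == 0%N)%:R * 1)); last first.
    by move=> s sz /=; rewrite size_rcons (perm_size sz) mulr1.
  by rewrite perm_sumZ /=; case: M {sM MN} => [|m M] /=; rewrite ?mul0r ?mulr0 ?mul1r.
have MN' : all (ltn^~ N) M by apply: sub_all MN => m /andP[].
have Mx : all (ltn x.+1) M by apply: sub_all MN => m /andP[].
pose V s := value_maxima x (rcons s N).
rewrite (@eq_perm_sum _ _ _ _ (fun s => P x.+1 * ins_sum q x.+1 V s +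
   (((size M)%:R + t) * V s + 2 * Q x.+1 * del_sum N V s))); last first.
  move=> s sz /=; rewrite size_rcons (perm_size sz) /=.
  rewrite /del_sum asc_del_rcons big_map /ins_sum ins_tail_rcons.
  rewrite -[rcons (map _ _) _]cats1 big_cat big_map big_seq1 /=.
  (* The insertion behind N contributes nothing. *)
  rewrite (@value_maxima_last x (rcons (rcons s N) x.+1)).
  - by rewrite /V -/(rcons _ _); ring.
  - exact: ltnW.
  - rewrite all_rcons (ltnW xN) all_rcons leqnn (perm_all _ sz).
    by apply: sub_all MN' => m /ltnW.
  - by rewrite mem_rcons inE mem_rcons mem_head orbT.
  - by rewrite last_rcons.
rewrite !perm_sumD !perm_sumZ.
have IHM M' : sorted ltn M' -> all (fun m => x < m < N)%N M' ->
    perm_sum q M' V = perm_factor (size M') * value_count x (size M').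
  by apply: IH; apply: ltnW.
have -> : perm_sum q M (ins_sum q x.+1 V) = perm_sum q (x.+1 :: M) V by [].
have sub_x : subpred (fun m => x.+1 < m < N)%N (fun m => x < m < N)%N.
  by move=> m /andP[/ltnW-> ->].
have MNx : all (fun m => x < m < N)%N M by apply: sub_all MN.
rewrite (IHM M) // (IHM (x.+1 :: M)) /= ?path_min_sorted ?ltnSn ?xN //.
rewrite [2 * Q _ * _]mulrAC.
rewrite (@perm_sum_del_sum _ _ _ _ _
   (perm_factor (size M).-1 * value_count x (size M).-1)) //; last first.
  move=> M' subM sz; rewrite IHM -?sz //.
    exact: subseq_sorted ltn_trans _ _ subM sM.
  by apply/allP=> m /(mem_subseq subM)/(allP MN)/sub_x.
by case: (size M) => [|c] /=; rewrite -?natr1; ring.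
Qed.

Lemma value_maxima_count x : (x < N)%N ->
  value_maxima x [:: N] = value_count x 0.
Proof.
by move=> xN; have := @perm_sum_value_maxima x [::] xN; rewrite /= mul1r; apply.
Qed.

End ValueFunctions.

(** * Rows of blocks *)

(** An empty [a] means that no block is there to be glued to. *)
Definition opt_block (a : seq nat) : seq (seq nat) := nseq (a != [::]) a.

(** A code [(i, (l, r))] puts [x] in the gap before block number [i], glued to
    the block on its left if [l] and to the one on its right if [r]. *)
Definition glue (x : nat) (ss : seq (seq nat)) (c : nat * (bool * bool)) :=
  let: (i, (l, r)) := c in
  take (i - l) ss
  ++ ((if l then nth [::] ss i.-1 else [::]) ++ x
      :: (if r then nth [::] ss i else [::])) :: drop (i + r) ss.

Arguments glue : simpl never.

Definition gap_codes (m : nat) : seq (nat * (bool * bool)) :=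
  [seq c <- [seq (i, b) | i <- iota 0 m.+1,
      b <- [:: (false, false); (false, true); (true, false); (true, true)]]
   | (c.2.1 ==> (0 < c.1)) && (c.2.2 ==> (c.1 < m))].

Lemma gap_codes_uniq m : uniq (gap_codes m).
Proof.
by apply/filter_uniq/allpairs_uniq => // [|[? ?] [? ?]]; rewrite ?iota_uniq.
Qed.

Lemma mem_gap_codes m (i : nat) (l r : bool) :
  ((i, (l, r)) \in gap_codes m) = [&& i <= m, l ==> (0 < i) & r ==> (i < m)].
Proof.
rewrite mem_filter andbC; congr (_ && _); rewrite -ltnS.
apply/allpairsP/idP => [[[j b] [+ _ [-> _]]] | im].
  by rewrite mem_iota.
by exists (i, (l, r)); rewrite mem_iota; split=> //; case: l; case: r.
Qed.

(** A normal form of gluing: if [a] and [b] are the parts of the new block before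
    and after [x], then [x] was glued exactly to the nonempty ones.  It gives
    injectivity and surjectivity of the insertions. *)
Lemma glueE x A a b B :
  glue x ((A ++ opt_block a) ++ opt_block b ++ B)
    (size A + (a != [::]), (a != [::], b != [::])) = A ++ (a ++ x :: b) :: B.
Proof.
rewrite /glue /opt_block -catA addnK take_size_cat //; congr (_ ++ _).
case: a b => [|a1 a] [|b1 b] /=; rewrite ?addn0 ?addn1.
- by rewrite drop_size_cat.
- by rewrite nth_cat ltnn subnn -(cat_rcons _ A) drop_size_cat ?size_rcons.
- by rewrite nth_cat ltnn subnn -(cat_rcons _ A) drop_size_cat ?size_rcons.
- rewrite !nth_cat ltnn subnn ltnNge leqnSn subSnn /=.
  by rewrite -(cat_rcons _ A) -(cat_rcons _ _ B) drop_size_cat ?size_rcons.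
Qed.

Lemma gap_codeP (ss : seq (seq nat)) (c : nat * (bool * bool)) :
  [::] \notin ss -> c \in gap_codes (size ss) ->
  exists A a b B, ss = (A ++ opt_block a) ++ opt_block b ++ B /\
    c = (size A + (a != [::]), (a != [::], b != [::])).
Proof.
case: c => i [l r] nss; rewrite mem_gap_codes => /and3P[im li ri].
have nn j : j < size ss -> nth [::] ss j != [::].
  by move=> jm; apply: contraNneq nss => <-; apply: mem_nth.
exists (take (i - l) ss), (if l then nth [::] ss i.-1 else [::]),
  (if r then nth [::] ss i else [::]), (drop (i + r) ss).
have la : ((if l then nth [::] ss i.-1 else [::]) != [::]) = l.
  by case: l li => //= i0; rewrite nn //; lia.
have rb : ((if r then nth [::] ss i else [::]) != [::]) = r.
  by case: r ri => //= ?; rewrite nn.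
rewrite /opt_block la rb size_take_min; split; last first.
  by congr pair; case: l li {la} => /=; lia.
have -> : take (i - l) ss ++ nseq l (if l then nth [::] ss i.-1 else [::]) =
    take i ss.
  case: l li {la} => /= [i0|_]; rewrite ?subn0 ?cats0 // subn1 cats1.
  by rewrite -take_nth ?prednK //; lia.
by case: r ri {rb} => /= im'; rewrite ?addn0 ?addn1 -?drop_nth ?cat_take_drop.
Qed.

Lemma cat_cons_inj (T : eqType) (p : pred T) A A' (y y' : T) B B' :
  ~~ has p A -> ~~ has p A' -> p y -> p y' ->
  A ++ y :: B = A' ++ y' :: B' -> [/\ A = A', y = y' & B = B'].
Proof.
move=> pA pA' py py' eqs; have := congr1 (find p) eqs.
rewrite !find_cat (negPf pA) (negPf pA') /= py py' !addn0 => sz.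
move/eqP: eqs; rewrite eqseq_cat // => /andP[/eqP-> /eqP[-> ->]].
by split.
Qed.

Lemma flatten_opt_block a : flatten (opt_block a) = a.
Proof. by rewrite /opt_block; case: a => //= *; rewrite cats0. Qed.

Lemma glue_inj (x : nat) (ss ss' : seq (seq nat)) (c c' : nat * (bool * bool)) :
  [::] \notin ss -> [::] \notin ss' -> x \notin flatten ss -> x \notin flatten ss' ->
  c \in gap_codes (size ss) -> c' \in gap_codes (size ss') ->
  glue x ss c = glue x ss' c' -> ss = ss' /\ c = c'.
Proof.
move=> nss nss' xs xs' /(gap_codeP nss)[A [a [b [B [ess ->]]]]].
move=> /(gap_codeP nss')[A' [a' [b' [B' [ess' ->]]]]].
rewrite {1}ess {1}ess' !glueE; move: xs xs'; rewrite ess ess'.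
rewrite !flatten_cat !flatten_opt_block !mem_cat !negb_or.
case/and3P=> /andP[xA xa] _ _ /and3P[/andP[xA' xa'] _ _].
have noA D : x \notin flatten D -> ~~ has (fun d => x \in d) D.
  by apply: contra => /hasP[d dD xd]; apply/flattenP; exists d.
have no1 (u : seq nat) : x \notin u -> ~~ has (pred1 x) u by rewrite has_pred1.
case/(@cat_cons_inj _ (fun d : seq nat => x \in d));
  rewrite ?noA ?mem_cat ?mem_head ?orbT //.
move=> -> + -> /=; case/(@cat_cons_inj _ (pred1 x)); rewrite ?no1 ?eqxx //=.
by move=> -> _ ->.
Qed.

Fixpoint states (l : seq nat) : seq (seq (seq nat)) :=
  if l is x :: l' then
    [seq glue x ss c | ss <- states l', c <- gap_codes (size ss)]
  else [:: [::]].

Lemma perm_glue (x : nat) A a b B (l : seq nat) :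
  perm_eq (flatten (A ++ (a ++ x :: b) :: B)) (x :: l) =
  perm_eq (flatten ((A ++ opt_block a) ++ opt_block b ++ B)) l.
Proof.
rewrite !flatten_cat !flatten_opt_block /=.
by apply/seq.permP/seq.permP => e p; have := e p; rewrite /= !count_cat /=; lia.
Qed.

(** Every way of cutting an arrangement of [l] into blocks is reached by a
    unique history (with [states_uniq]): remove the last inserted letter from
    the block that contains it. *)
Lemma mem_states (l : seq nat) (ss : seq (seq nat)) : uniq l ->
  (ss \in states l) = ([::] \notin ss) && perm_eq (flatten ss) l.
Proof.
elim: l ss => [|x l IH] ss.
  move=> _; rewrite /= inE; case: ss => [|[|y a] ss] //=.
  by rewrite andbC; case: seq.permP => // /(_ predT).
case/andP=> xl ul; apply/allpairsPdep/andP.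
  case=> ss0 [c [+ cP ->]]; rewrite IH // => /andP[nss0 pss0].
  have [A [a [b [B [ess ec]]]]] := gap_codeP nss0 cP.
  rewrite ess ec glueE perm_glue -ess pss0; split=> //.
  move: nss0; rewrite ess !mem_cat inE !negb_or => /and3P[/andP[-> _] _ ->].
  by case: (a).
case=> nss pss; have : x \in flatten ss by rewrite (perm_mem pss) mem_head.
case/flattenP=> d dss xd; case/splitPr: dss nss pss => A B nss pss.
case/splitPr: xd nss pss => a b nss pss.
exists ((A ++ opt_block a) ++ opt_block b ++ B).
exists (size A + (a != [::]), (a != [::], b != [::])).
rewrite glueE IH //; split=> //.
  rewrite -(perm_glue x) pss andbT.
  move: nss; rewrite !mem_cat !inE !negb_or => /and3P[-> _ ->] /=.
  by rewrite !mem_nseq; case: (a); case: (b).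
rewrite mem_gap_codes !size_cat !size_nseq.
by case: (a); case: (b) => * /=; lia.
Qed.

Lemma states_uniq (l : seq nat) : uniq l -> uniq (states l).
Proof.
elim: l => // x l IH /andP[xl ul].
apply: allpairs_uniq_dep; first exact: IH.
  by move=> ss _; apply: gap_codes_uniq.
move=> [ss c] [ss' c'] /allpairsPdep[s [d [ssS cP [-> ->]]]].
move=> /allpairsPdep[s' [d' [ssS' cP' [-> ->]]]] /= eg.
move: ssS ssS'; rewrite !mem_states // => /andP[ns ps] /andP[ns' ps'].
by case: (glue_inj ns ns' _ _ cP cP' eg);
  rewrite ?(perm_mem ps) ?(perm_mem ps') // => -> ->.
Qed.

(** * Weights of letters in context *)

Definition max_of (s : seq nat) : nat := \max_(y <- s) y.

(** All that the weight of a letter [y] sees of the word on one of its sides,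
    read away from [y]. *)
Definition same_view (y : nat) (r r' : seq nat) : Prop :=
  [/\ (head 0 r < y) = (head 0 r' < y),
      all (ltn^~ y) r = all (ltn^~ y) r' &
      prefix_above y r = prefix_above y r'].

Lemma prefix_above_cons y z r :
  prefix_above y (z :: r) = if y < z then z :: prefix_above y r else [::].
Proof. by rewrite /prefix_above /= leqNgt; case: ltnP. Qed.

Lemma same_view_cat y a r r' : same_view y r r' -> same_view y (a ++ r) (a ++ r').
Proof.
move=> vr; elim: a => //= z a [_ eall epre]; split=> //=; first by rewrite eall.
by rewrite !prefix_above_cons epre.
Qed.

(** Letters below [y] act on the view of [y] like the separator 0.  This is why
    later insertions do not change the weight of [y]. *)
Lemma same_view_small y m r : 0 < y -> m != [::] -> all (ltn^~ y) m ->
  same_view y (0 :: r) (m ++ r).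
Proof.
case: m => //= z m y0 _ /andP[zy my]; split=> /=.
- by rewrite zy y0.
- by rewrite all_cat my y0 zy.
- by rewrite !prefix_above_cons [y < z]ltnNge (ltnW zy).
Qed.

Lemma prefix_above_cat x a r : all (ltn x) a ->
  prefix_above x (a ++ 0 :: r) = a.
Proof.
by elim: a => [|z a IH] /=; rewrite prefix_above_cons //= => /andP[-> /IH->].
Qed.

Section Weights.
Local Open Scope ring_scope.
Variables (R : comNzRingType) (P Q : nat -> R) (ql qr t : R) (ord : rel nat).

(** The words [l] and [r] are the two contexts of [y], both read away from [y];
    0 is a separator of blocks and has weight 1.  Depending on the two
    neighbours, [y] is a peak, a double ascent, a double descent or a valley;
    [ord] is the condition on the maxima of the factors lambda and rho. *)
Definition letter_weight (l : seq nat) (y : nat) (r : seq nat) : R :=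
  if y == 0%N then 1 else
  if (head 0 l < y)%N then
    if (head 0 r < y)%N then
      P y * ql ^+ all (ltn^~ y) l * qr ^+ all (ltn^~ y) r
    else t ^+ all (ltn^~ y) l
  else
    if (head 0 r < y)%N then 0
    else Q y * (ord (max_of (prefix_above y l)) (max_of (prefix_above y r)))%:R.

Fixpoint context_weight (l z r : seq nat) : R :=
  if z is y :: z' then letter_weight l y (z' ++ r) * context_weight (y :: l) z' r
  else 1.

Lemma context_weight_cat l a b r :
  context_weight l (a ++ b) r =
  context_weight l a (b ++ r) * context_weight (rev a ++ l) b r.
Proof.
elim: a l => [|y a IH] l /=; first by rewrite mul1r.
by rewrite IH rev_cons cat_rcons catA mulrA.
Qed.

Lemma eq_letter_weight l l' y r r' :
  ((0 < y)%N -> same_view y l l') -> ((0 < y)%N -> same_view y r r') ->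
  letter_weight l y r = letter_weight l' y r'.
Proof.
rewrite /letter_weight; case: posnP => // y0 /(_ isT)[-> -> ->] /(_ isT)[-> -> ->].
by [].
Qed.

Lemma eq_context_weight l l' z r r' :
  (forall y, y \in z -> (0 < y)%N -> same_view y l l' /\ same_view y r r') ->
  context_weight l z r = context_weight l' z r'.
Proof.
elim: z l l' => //= y z IH l l' views; congr (_ * _).
  apply: eq_letter_weight => y0.
    by case: (views y); rewrite ?mem_head.
  by apply: same_view_cat; case: (views y); rewrite ?mem_head.
apply: IH => u uz u0; have [] := views u _ u0; first by rewrite inE uz orbT.
by move=> vl vr; split=> //; apply: (@same_view_cat _ [:: y]).
Qed.

(** Blocks are separated and surrounded by zeros: a row [A ++ B] is written
   [zprefix A ++ 0 :: zsuffix B], the middle zero being the gap. *)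
Definition zprefix (A : seq (seq nat)) : seq nat := flatten [seq 0%N :: a | a <- A].
Definition zsuffix (B : seq (seq nat)) : seq nat := flatten [seq rcons b 0%N | b <- B].

Lemma zsuffix_cat A B :
  0%N :: zsuffix (A ++ B) = zprefix A ++ 0%N :: zsuffix B.
Proof.
elim: A => //= a A; rewrite /zsuffix /zprefix /= => IH.
by rewrite -cats1 -!catA /= IH.
Qed.

Definition state_weight (ss : seq (seq nat)) : R :=
  context_weight [::] (0%N :: zsuffix ss) [::].

Definition glue_weight (x : nat) (ss : seq (seq nat)) (c : nat * (bool * bool)) : R :=
  match c with
  | (i, (false, false)) => P x * ql ^+ (i == 0%N) * qr ^+ (i == size ss)
  | (i, (false, true)) => t ^+ (i == 0%N)
  | (i, (true, false)) => 0
  | (i, (true, true)) =>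
      Q x * (ord (max_of (nth [::] ss i.-1)) (max_of (nth [::] ss i)))%:R
  end.

Lemma mem_zprefix A y : y \in zprefix A -> (0 < y)%N -> y \in flatten A.
Proof.
case/flattenP=> _ /mapP[a aA ->]; rewrite inE => /predU1P[->|ya] // _.
by apply/flattenP; exists a.
Qed.

Lemma mem_zsuffix A y : y \in zsuffix A -> (0 < y)%N -> y \in flatten A.
Proof.
case/flattenP=> _ /mapP[a aA ->]; rewrite mem_rcons inE => /predU1P[->|ya] // _.
by apply/flattenP; exists a.
Qed.

(** The old letters keep their weights by [same_view_small]; the weight of [x] is
    read off its code. *)
Lemma state_weight_glue x ss c : (0 < x)%N -> all (ltn x) (flatten ss) ->
  [::] \notin ss -> c \in gap_codes (size ss) ->
  state_weight (glue x ss c) = state_weight ss * glue_weight x ss c.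
Proof.
move=> x0 xss nss /(gap_codeP nss)[A [a [b [B [ess ->]]]]].
rewrite {1}ess glueE.
have [nA na] : [::] \notin A /\ [::] \notin B.
  by move: nss; rewrite ess !mem_cat !negb_or => /andP[/andP[-> _] /andP[_ ->]].
set u := zprefix (A ++ opt_block a); set s := zsuffix (opt_block b ++ B).
set m1 := nseq (a == [::]) 0%N; set m2 := nseq (b == [::]) 0%N.
(* The gap is the zero of [u ++ 0 :: s]; inserting x replaces it by
   [m1 ++ x :: m2], which keeps a zero on each side where x is not glued. *)
have zg : 0%N :: zsuffix (A ++ (a ++ x :: b) :: B) = u ++ (m1 ++ x :: m2) ++ s.
  rewrite zsuffix_cat /u /s /zprefix map_cat flatten_cat -catA.
  congr (_ ++ _); rewrite /zsuffix /m1 /m2 /opt_block.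
  case: (a) => [|a1 a']; case: (b) => [|b1 b'] //=; rewrite ?cats0 ?rcons_cat /=.
  - by rewrite -catA.
  - by rewrite -catA.
have zs : 0%N :: zsuffix ss = u ++ [:: 0%N] ++ s by rewrite ess zsuffix_cat.
rewrite /state_weight zg zs !context_weight_cat !cats0.
have big_u y : y \in u -> (0 < y)%N -> (x < y)%N.
  move=> yu y0; have := allP xss y; apply; rewrite ess flatten_cat mem_cat.
  by rewrite (mem_zprefix yu).
have big_s y : y \in s -> (0 < y)%N -> (x < y)%N.
  move=> ys y0; have := allP xss y; apply; rewrite ess flatten_cat mem_cat.
  by rewrite (mem_zsuffix ys) ?orbT.
have zero_weight l k r : context_weight l (nseq k 0%N) r = 1.
  by elim: k l => //= k IH l; rewrite IH mulr1.
set m := m1 ++ x :: m2.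
have small_m y : (x < y)%N -> all (ltn^~ y) m.
  move=> xy; have y0 := leq_ltn_trans (leq0n x) xy.
  by rewrite all_cat /= xy !all_nseq y0 !orbT.
have m_n0 : m != [::] by rewrite -size_eq0 size_cat /= addnS.
have -> : context_weight [::] u (m ++ s) = context_weight [::] u ([:: 0%N] ++ s).
  apply: eq_context_weight => y yu y0; split=> //.
  have [v1 v2 v3] := same_view_small s y0 m_n0 (small_m y (big_u y yu y0)).
  by split; rewrite ?v1 ?v2 ?v3.
have -> : context_weight (rev m ++ rev u) s [::] =
    context_weight (rev [:: 0%N] ++ rev u) s [::].
  apply: eq_context_weight => y ys y0; split=> //.
  have := @same_view_small y (rev m) (rev u) y0.
  rewrite all_rev -size_eq0 size_rev size_eq0.
  by case/(_ m_n0 (small_m y (big_s y ys y0))) => v1 v2 v3; split; rewrite ?v1 ?v2 ?v3.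
rewrite !zero_weight (zero_weight _ 1%N) /= zero_weight !mul1r mulr1.
rewrite mulrCA mulrC; congr (_ * _).
have [xA xa xb xB] : [/\ all (ltn x) (flatten A), all (ltn x) a,
    all (ltn x) b & all (ltn x) (flatten B)].
  by move: xss; rewrite ess !flatten_cat !flatten_opt_block !all_cat;
    case/andP=> /andP[-> ->] /andP[-> ->].
have left_end : a = [::] -> [/\ rev m1 ++ rev u = 0%N :: rev (zprefix A)
    & all (ltn^~ x) (0%N :: rev (zprefix A)) = (size A == 0%N)].
  rewrite /m1 /u => -> /=; rewrite cats0 x0 all_rev; split=> //.
  case: A nA xA {ess zg zs u big_u} => //= -[|y d] A; rewrite ?mem_head //.
  by rewrite /zprefix /= => _ /andP[/ltnW xy _]; rewrite [(y < x)%N]ltnNge xy andbF.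
have right_end : b = [::] -> [/\ m2 ++ s = 0%N :: zsuffix B
    & all (ltn^~ x) (0%N :: zsuffix B) = (size B == 0%N)].
  rewrite /m2 /s => -> /=; rewrite x0; split=> //.
  case: B na xB {ess zg zs s big_s} => //= -[|y d] B; rewrite ?mem_head //.
  by rewrite /zsuffix /= => _ /andP[/ltnW xy _]; rewrite [(y < x)%N]ltnNge xy.
have left_in : a != [::] -> rev m1 ++ rev u = rev a ++ 0%N :: rev (zprefix A).
  rewrite /m1 /u /opt_block => an; rewrite (negPf an) /= /zprefix.
  by rewrite map_cat flatten_cat rev_cat /= cats0 rev_cons cat_rcons.
have right_in : b != [::] -> m2 ++ s = b ++ 0%N :: zsuffix B.
  rewrite /m2 /s /opt_block => bn; rewrite (negPf bn) /= /zsuffix.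
  by rewrite /= cat_rcons.
have head_big d r : d != [::] -> all (ltn x) d -> (head 0%N (d ++ r) < x)%N = false.
  by case: d => //= y d _ /andP[/ltnW xy _]; rewrite ltnNge xy.
have ran : (rev a != [::]) = (a != [::]) by rewrite -!size_eq0 size_rev.
rewrite /letter_weight (gtn_eqF x0).
have [a0 | an] := eqVneq a [::]; have [b0 | bn] := eqVneq b [::] => /=.
- have [-> allA] := left_end a0; have [-> allB] := right_end b0.
  rewrite allA allB /= x0 addn0; congr (_ * _ ^+ nat_of_bool _).
  rewrite ess a0 b0 /= cats0 size_cat; move: (size A) (size B) => m' p; clear; lia.
- have [-> allA] := left_end a0; rewrite right_in // allA /= x0.
  by rewrite head_big // addn0.
- by have [-> _] := right_end b0; rewrite left_in // head_big ?ran ?all_rev // x0.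
rewrite left_in // right_in // !head_big ?ran ?all_rev //.
rewrite !prefix_above_cat ?all_rev // addn1 /=.
have -> : max_of (rev a) = max_of a by apply/perm_big; rewrite perm_rev.
rewrite ess /opt_block an bn /= -catA /= !nth_cat ltnn subnn ltnNge leqnSn.
by rewrite subSnn.
Qed.

End Weights.

(** * One insertion step *)

Section Steps.
Local Open Scope ring_scope.
Variables (R : comNzRingType) (P Q : nat -> R).

Lemma sum_gap_codes m (F : nat * (bool * bool) -> R) :
  \sum_(c <- gap_codes m) F c =
  \sum_(0 <= i < m.+1) F (i, (false, false)) + \sum_(0 <= i < m) F (i, (false, true))
  + \sum_(0 <= i < m) F (i.+1, (true, false))
  + \sum_(0 <= i < m.-1) F (i.+1, (true, true)).
Proof.
rewrite big_filter big_mkcond big_allpairs_dep /=.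
under eq_bigr => i _ do rewrite !big_cons big_nil /= !andbT addr0.
rewrite -/(iota 0 m.+1) (_ : iota 0 m.+1 = index_iota 0 m.+1); last first.
  by rewrite /index_iota subn0.
rewrite !big_split /= !addrA; congr (_ + _ + _ + _).
- rewrite big_nat_recr //= ltnn addr0; apply: eq_big_nat => i im.
  by rewrite (andP im).2.
- by rewrite big_nat_recl //= add0r.
rewrite big_nat_recl //= add0r; case: m => [|m] /=; first by rewrite !big_geq.
rewrite big_nat_recr //= ltnn addr0; apply: eq_big_nat => i im.
by rewrite ltnS (andP im).2.
Qed.

Lemma size_glue x (ss : seq (seq nat)) i l r : (i, (l, r)) \in gap_codes (size ss) ->
  (size (glue x ss (i, (l, r))) + l + r = (size ss).+1)%N.
Proof.
rewrite mem_gap_codes size_cat /= size_take_min size_drop.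
by case: l; case: r => /=; lia.
Qed.

Lemma sum_state_glue (ql qr t : R) ord x (ss : seq (seq nat)) (V : seq (seq nat) -> R) :
  (0 < x)%N -> all (ltn x) (flatten ss) -> [::] \notin ss ->
  let W := state_weight P Q ql qr t ord in
  \sum_(c <- gap_codes (size ss)) W (glue x ss c) * V (glue x ss c) =
  W ss * (P x * \sum_(0 <= i < (size ss).+1)
             ql ^+ (i == 0%N) * qr ^+ (i == size ss) * V (glue x ss (i, (false, false)))
   + \sum_(0 <= i < size ss) t ^+ (i == 0%N) * V (glue x ss (i, (false, true)))
   + Q x * \sum_(0 <= i < (size ss).-1)
       (ord (max_of (nth [::] ss i)) (max_of (nth [::] ss i.+1)))%:R
         * V (glue x ss (i.+1, (true, true)))).
Proof.
move=> x0 xss nss W; rewrite (@eq_big_seq _ _ _ _ _ _ (fun c =>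
  W ss * (glue_weight P Q ql qr t ord x ss c * V (glue x ss c)))); last first.
  by move=> c cP; rewrite /W state_weight_glue // mulrA.
rewrite -mulr_sumr sum_gap_codes /=; congr (_ * _).
rewrite [X in _ + X + _]big1 => [|i _]; last by rewrite mul0r.
rewrite addr0 !mulr_sumr; congr (_ + _ + _); apply: eq_bigr => i _.
  by rewrite !mulrA.
by rewrite mulrA.
Qed.

Lemma insE_iota x s :
  ins x s = [seq take i s ++ x :: drop i s | i <- iota 0 (size s).+1].
Proof.
elim: s => [|y s IH] //; rewrite [LHS]/= IH -map_comp.
rewrite -[iota 0 (size (y :: s)).+1]/(0%N :: iota (1 + 0)%N (size s).+1).
by rewrite iotaDl [RHS]map_cons -map_comp.
Qed.

Lemma ins_sum_nat q x (F : seq nat -> R) s :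
  ins_sum q x F s =
  \sum_(0 <= i < (size s).+1) q ^+ (i == 0%N) * F (take i s ++ x :: drop i s).
Proof.
rewrite big_nat_recl //= take0 drop0 /ins_sum; congr (_ + _).
have := insE_iota x s; rewrite insE /= take0 drop0 => -[->].
rewrite -[iota 1 _]/(iota (1 + 0)%N _) iotaDl -map_comp big_map /index_iota subn0.
by apply: eq_bigr => i _; rewrite mul1r.
Qed.

Lemma del_sum_nat N (F : seq nat -> R) s :
  del_sum N F s =
  \sum_(0 <= i < size s)
    (nth N s i < nth N s i.+1)%:R * F (take i s ++ drop i.+1 s).
Proof.
elim: s F => [|y s IH] F; first by rewrite /del_sum /= big_nil big_geq.
by rewrite del_sum_cons IH /= big_nat_recl //= drop0 -nth0.
Qed.

End Steps.

Section ValueSteps.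
Local Open Scope ring_scope.
Variables (R : comNzRingType) (P Q : nat -> R).

(** Of the [m + 2] gaps around [m + 1] blocks the first and the last have weight
    [q] for a peak; only the first gap has weight [t] for a double ascent. *)
Lemma count_step (q t : R) x (ss : seq (seq nat)) :
  all (ltn x.+1) (flatten ss) -> [::] \notin ss -> ss != [::] ->
  let W := state_weight P Q q q t (fun _ _ => true) in
  let V x ss := value_count P Q q t x (size ss).-1 in
  \sum_(c <- gap_codes (size ss)) W (glue x.+1 ss c) * V x (glue x.+1 ss c) =
  W ss * V x.+1 ss.
Proof.
move=> xss nss ss0 W V; rewrite sum_state_glue //; congr (_ * _).
have [m em] : exists m, size ss = m.+1.
  by case: (ss) ss0 => // a s _; exists (size s).
have sz i l r : (i, (l, r)) \in gap_codes (size ss) ->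
    (size (glue x.+1 ss (i, (l, r)))).-1 = (m.+1 - l - r)%N.
  by move/(size_glue x.+1); rewrite em; lia.
rewrite /V em /=; congr (_ + _ + _).
- rewrite -mulrA; congr (_ * _).
  rewrite (@eq_big_nat _ _ _ _ _ _ (fun i => q ^+ (i == 0%N) * q ^+ (i == m.+1)
      * value_count P Q q t x m.+1)); last first.
    by move=> i im; rewrite sz ?subn0 // mem_gap_codes em; lia.
  rewrite -mulr_suml; congr (_ * _).
  rewrite big_nat_recl // big_nat_recr //= eqxx (eq_big_nat _ _ (F2 := fun=> 1)).
    by rewrite sumr_const_nat subn0 !expr1 !expr0; ring.
  by move=> i im; rewrite eqSS (ltn_eqF (andP im).2) mulr1.
- rewrite (@eq_big_nat _ _ _ _ _ _ (fun i => t ^+ (i == 0%N)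
      * value_count P Q q t x m)); last first.
    move=> i im; rewrite sz; last by rewrite mem_gap_codes em /=; lia.
    by rewrite subn0 subSS subn0.
  rewrite -mulr_suml; congr (_ * _).
  by rewrite big_nat_recl //= sumr_const_nat subn0 expr1 addrC.
rewrite (@eq_big_nat _ _ _ _ _ _ (fun i => value_count P Q q t x m.-1)).
  by rewrite sumr_const_nat subn0 -[X in X *+ _]mul1r -mulr_natl mulr1; ring.
move=> i im; rewrite sz ?mul1r; last by rewrite mem_gap_codes em /=; lia.
by congr value_count; lia.
Qed.

Lemma max_of_cat a b : max_of (a ++ b) = maxn (max_of a) (max_of b).
Proof. by rewrite /max_of big_cat. Qed.

Lemma max_of_cons x a : max_of (x :: a) = maxn x (max_of a).
Proof. by rewrite /max_of big_cons. Qed.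

Lemma max_of_gt x a : a != [::] -> all (ltn x) a -> (x < max_of a)%N.
Proof.
by case: a => //= y a _ /andP[xy _]; rewrite max_of_cons leq_max xy.
Qed.

(** On the list of block maxima a peak is an insertion, a double ascent changes
    nothing, and a valley, allowed only at an ascent, deletes the smaller of the
    two maxima that it joins. *)
Lemma maxima_step (q t : R) x (ss : seq (seq nat)) :
  all (ltn x.+1) (flatten ss) -> [::] \notin ss -> ss != [::] ->
  let W := state_weight P (fun y => 2 * Q y) q 1 t ltn in
  let V x ss := value_maxima P Q q t x (map max_of ss) in
  \sum_(c <- gap_codes (size ss)) W (glue x.+1 ss c) * V x (glue x.+1 ss c) =
  W ss * V x.+1 ss.
Proof.
move=> xss nss ss0 W V; rewrite sum_state_glue //; congr (_ * _).
have big i : (i < size ss)%N -> (x.+1 < max_of (nth [::] ss i))%N.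
  move=> im; have si := mem_nth [::] im; apply: max_of_gt.
    by apply: contraNneq nss => <-.
  apply/allP=> y yi; apply: (allP xss); apply/flattenP; by exists (nth [::] ss i).
have nthmax i : nth 0%N (map max_of ss) i = max_of (nth [::] ss i).
  case: (ltnP i (size ss)) => im; first by rewrite (nth_map [::]).
  by rewrite !nth_default ?size_map // /max_of big_nil.
rewrite /V /=; congr (_ + _ + _).
- rewrite ins_sum_nat size_map; congr (_ * _); apply: eq_big_nat => i im.
  rewrite expr1n mulr1; congr (_ * value_maxima _ _ _ _ _ _).
  by rewrite /glue map_cat /= subn0 addn0 map_take map_drop max_of_cons /max_of big_nil maxn0.
- rewrite (@eq_big_nat _ _ _ _ _ _ (fun i => t ^+ (i == 0%N)
      * value_maxima P Q q t x (map max_of ss))).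
    rewrite -mulr_suml; congr (_ * _); rewrite size_map.
    case: (ss) ss0 => // a s _ /=.
    by rewrite big_nat_recl //= sumr_const_nat subn0 expr1 addrC.
  move=> i /andP[_ im]; congr (_ * value_maxima _ _ _ _ _ _).
  rewrite /glue map_cat /= subn0 addn1 max_of_cons (maxn_idPr (ltnW (big i im))).
  by rewrite -map_cons -drop_nth // -map_cat cat_take_drop.
congr (_ * _); rewrite del_sum_nat size_map.
case es: (size ss) => [|m] /=; first by rewrite !big_geq.
rewrite [RHS]big_nat_recr //= !nthmax [nth _ _ m.+1]nth_default ?es //.
have -> : max_of [::] = 0%N by rewrite /max_of big_nil.
rewrite ltn0 mul0r addr0; apply: eq_big_nat => i /andP[_ im].
rewrite !nthmax; case lti: (_ < _)%N; last by rewrite !mul0r.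
congr (_ * value_maxima _ _ _ _ _ _).
rewrite /glue map_cat /= subSS subn0 addn1 max_of_cat max_of_cons.
have b2 := ltnW (big i.+1 _); rewrite (maxn_idPr (b2 _)) ?es // (maxn_idPr (ltnW lti)).
by rewrite map_take -map_cons -drop_nth ?es // map_drop.
Qed.

End ValueSteps.

(** * Sums over permutations *)

Section Totals.
Local Open Scope ring_scope.
Variables (R : comNzRingType).

Lemma sum_states_perm N (W : seq (seq nat) -> R) : (0 < N)%N ->
  \sum_(ss <- states (iota 1 N)) W ss * (size ss == 1%N)%:R =
  \sum_(w <- permutations (iota 1 N)) W [:: w].
Proof.
move=> N0; under eq_bigr => ss _ do rewrite mulr_natr mulrb.
rewrite -big_mkcond -big_filter -[RHS](big_map (fun w => [:: w]) xpredT).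
apply: perm_big; apply: uniq_perm; first exact/filter_uniq/states_uniq/iota_uniq.
  by rewrite map_inj_uniq ?permutations_uniq // => u v [].
move=> ss; rewrite mem_filter mem_states ?iota_uniq //.
apply/and3P/mapP => [[+ nss]|[w + ->]].
  case: ss nss => [|w [|? ?]] //= _ _; rewrite cats0 => pw.
  by exists w; rewrite ?mem_permutations.
rewrite mem_permutations /= cats0 => pw; split=> //.
by rewrite inE; apply: contraTneq pw => <-; case: (N) N0.
Qed.

(** The value functions make the total over the rows of blocks independent of the
    stage; it is evaluated when only [N] has been inserted. *)
Lemma sum_states_value N (W : seq (seq nat) -> R) (V : nat -> seq (seq nat) -> R) :
  (0 < N)%N ->
  (forall x ss, all (ltn x.+1) (flatten ss) -> [::] \notin ss -> ss != [::] ->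
    \sum_(c <- gap_codes (size ss)) W (glue x.+1 ss c) * V x (glue x.+1 ss c) =
    W ss * V x.+1 ss) ->
  \sum_(ss <- states (iota 1 N)) W ss * V 0%N ss =
  W [:: [:: N]] * V N.-1 [:: [:: N]].
Proof.
move=> N0 step.
have down x : (x < N)%N -> \sum_(ss <- states (iota 1 N)) W ss * V 0%N ss =
    \sum_(ss <- states (iota x.+1 (N - x))) W ss * V x ss.
  elim: x => [|x IH] xN; first by rewrite subn0.
  rewrite IH ?(ltnW xN) //.
  have -> : states (iota x.+1 (N - x)) = [seq glue x.+1 ss c
      | ss <- states (iota x.+2 (N - x.+1)), c <- gap_codes (size ss)].
    by rewrite -(subnSK (ltnW xN)).
  rewrite big_allpairs_dep; apply: eq_big_seq => ss.
  rewrite mem_states ?iota_uniq // => /andP[nss pss]; apply: step => //.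
    rewrite (perm_all _ pss); apply/allP=> y; rewrite mem_iota.
    by case/andP.
  by apply: contraTneq pss => ->; apply/negP => /perm_size; rewrite size_iota /=; lia.
rewrite (down N.-1) ?prednK // (_ : (N - N.-1 = 1)%N); last by lia.
by rewrite /= big_seq1.
Qed.

(** For arbitrary weights of peaks and valleys, marking maxima from both sides
    amounts to marking left-to-right maxima under the condition of Andre with
    each valley counted twice; the extra [q] marks the letter [N], always a
    right-to-left maximum. *)
Theorem sum_two_sided_one_sided (P Q : nat -> R) (q t : R) N : (0 < N)%N ->
  \sum_(w <- permutations (iota 1 N))
    state_weight P Q q q t (fun _ _ => true) [:: w] =
  q * \sum_(w <- permutations (iota 1 N))
    state_weight P (fun y => 2 * Q y) q 1 t ltn [:: w].
Proof.
move=> N0; rewrite -!sum_states_perm //.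
have eV ss : [::] \notin ss -> perm_eq (flatten ss) (iota 1 N) ->
    (size ss == 1%N) = ((size ss).-1 == 0%N).
  by case: ss => //= _ /perm_size; rewrite size_iota /=; lia.
rewrite (@eq_big_seq _ _ _ _ _ _ (fun ss => state_weight P Q q q t (fun _ _ => true) ss *
  value_count P Q q t 0 (size ss).-1)); last first.
  move=> ss; rewrite mem_states ?iota_uniq // => /andP[nss /(eV ss nss)] ->.
  by [].
rewrite (@sum_states_value _ _ (fun x ss => value_count P Q q t x (size ss).-1)) //;
  last exact: count_step.
under [X in q * X]eq_bigr => ss _ do rewrite -(size_map max_of ss).
rewrite (@sum_states_value _ _ (fun x ss =>
  value_maxima P Q q t x (map max_of ss))) //; last exact: maxima_step.
rewrite /= /max_of big_seq1 (@value_maxima_count _ _ _ _ _ N) ?prednK //.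
rewrite mulrA; congr (_ * _).
rewrite /state_weight /= /letter_weight /= (gtn_eqF N0) /= N0.
ring.
Qed.

End Totals.

(** * Statistics of a permutation word *)

Section WordStats.
Variables (N : nat) (s : 'S_N).
Local Notation w := (word s).

Lemma mem_positions i : (i \in positions w) = (0 < i <= N).
Proof. by rewrite mem_iota size_word; lia. Qed.

Lemma letter_neq_next i : 0 < i <= N -> letter w i != letter w i.+1.
Proof. by move=> iN; apply/eqP => /letter_inj; lia. Qed.

Lemma letter_neq_prev i : 0 < i <= N -> letter w i != letter w i.-1.
Proof.
case: i => // -[|i] iN; first by rewrite -lt0n letter_gt0.
by rewrite eq_sym letter_neq_next //; lia.
Qed.

Lemma head_drop i : head 0 (drop i w) = letter w i.+1.
Proof. by rewrite -nth0 nth_drop addn0. Qed.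

Lemma head_rev_take i : 0 < i <= N -> head 0 (rev (take i.-1 w)) = letter w i.-1.
Proof.
case: i => // -[|i] iN; first by rewrite take0.
rewrite -nth0 nth_rev size_take_min size_word; last by rewrite /=; lia.
by rewrite nth_take /letter /=; [congr nth; lia | lia].
Qed.

Lemma index_letter i : 0 < i <= N -> index (letter w i) w = i.-1.
Proof.
case: i => // i iN; rewrite /letter /= index_uniq ?size_word //.
by rewrite (perm_uniq (perm_word s)) iota_uniq.
Qed.

Lemma word_letters : w = [seq letter w i | i <- positions w].
Proof.
rewrite /positions -[iota 1 _]/(iota (1 + 0) _) iotaDl -map_comp.
by rewrite (@eq_map _ _ _ (nth 0 w)) // -/(mkseq _ _) mkseq_nth.
Qed.

Lemma all_word p : all p w = all (fun i => p (letter w i)) (positions w).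
Proof. by rewrite {1}word_letters all_map. Qed.

Lemma prefix_above_nil y r : 0 < y -> (prefix_above y r == [::]) = ~~ (y < head 0 r).
Proof. by case: r => [|z r] y0 //=; rewrite prefix_above_cons; case: ifP. Qed.

Definition left_max i := max_of (prefix_above (letter w i) (rev (take i.-1 w))).
Definition right_max i := max_of (prefix_above (letter w i) (drop i w)).

(** Without double descents, an empty rho forces an empty lambda, and the two are
    both nonempty exactly at the valleys. *)
Lemma andre1E : andre1 w =
  (dd w == 0) && all (fun i => valley w i ==> (left_max i < right_max i)) (positions w).
Proof.
rewrite /andre1 all_word.
have [|_] := boolP (dd w == 0) => //=; rewrite /dd -leqn0 leqNgt -has_count.
move/hasPn=> ndd; apply: eq_in_all => i ip; have := ip; rewrite mem_positions => iN.
have := ndd i ip; rewrite /= /ddescent /valley /lambda /rho.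
rewrite !index_letter // prednK; last by case/andP: iN.
rewrite -!size_eq0 size_rev !size_eq0 !prefix_above_nil ?letter_gt0 //.
rewrite head_drop head_rev_take // (_ : \max_(y <- rev _) y = left_max i); last first.
  by apply: perm_big; rewrite perm_rev.
rewrite -/(right_max i).
have := letter_neq_next iN; have := letter_neq_prev iN.
by case: (ltngtP (letter w i) (letter w i.-1)); case: (ltngtP (letter w i) (letter w i.+1)).
Qed.

Lemma count_split (T : Type) (a b : pred T) r :
  count a r = count (predI a b) r + count (predI a (predC b)) r.
Proof. by elim: r => //= x r ->; case: (a x); case: (b x) => /=; lia. Qed.

(** A left-to-right maximum exceeds its left neighbour, so its right neighbour
    decides between peak and double ascent. *)
Lemma lmaxE : lmax w = lmaxpk w + lmaxda w.
Proof.
rewrite /lmax (count_split _ (peak w)); congr (_ + _); apply: eq_in_count => i.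
rewrite mem_positions => iN /=; case lm: (is_lmax w i) => //=.
have : letter w i.-1 < letter w i.
  case: i iN lm => // -[|i] iN; first by rewrite letter_gt0.
  move/allP=> /(_ (letter w i.+1)); apply; rewrite /letter /=.
  by rewrite -(nth_take 0 (ltnSn i)) mem_nth // size_take_min size_word; lia.
have := letter_neq_next iN; rewrite /peak /dascent => + ->.
by case: ltngtP.
Qed.

Lemma rmaxE : dd w == 0 -> rmax w = rmaxpk w.
Proof.
rewrite /dd -leqn0 leqNgt -has_count => /hasPn ndd.
apply: eq_in_count => i ip; have iN := ip; rewrite mem_positions in iN.
have := ndd i ip; rewrite /=; case rm: (is_rmax w i) => //=.
have lt_next : letter w i.+1 < letter w i.
  have [iN' | iN'] := ltnP i N; last first.
    by rewrite {1}/letter /= nth_default ?size_word // letter_gt0.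
  move/allP: rm => /(_ (letter w i.+1)); apply; rewrite -head_drop -nth0.
  by apply: mem_nth; rewrite size_drop size_word subn_gt0.
have := letter_neq_prev iN; rewrite /peak /ddescent lt_next andbT.
by case: ltngtP.
Qed.

(** A descent is counted at its bottom. *)
Lemma desE : des w = size (Val w) + dd w.
Proof.
rewrite /Val size_map size_filter /dd /des.
transitivity (count (fun i => letter w i < letter w i.-1) (positions w)).
  rewrite /positions; case: (size w) => //= m; rewrite add0n.
  by rewrite -[iota 2 m]/(iota (1 + 1) m) iotaDl count_map.
rewrite (count_split _ (valley w)); congr (_ + _); apply: eq_in_count => i.
  by rewrite /= /valley => _; case: ltnP.
rewrite mem_positions => iN; have := letter_neq_next iN.
rewrite /= /valley /ddescent; case: (letter w i < letter w i.-1) => /=.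
  by case: (ltngtP (letter w i) (letter w i.+1)).
by rewrite andbF.
Qed.

Lemma max_is_peak : 0 < N -> 0 < lmaxpk w /\ 0 < rmaxpk w.
Proof.
move=> N0; have Nw : N \in w by rewrite (perm_mem (perm_word s)) mem_iota; lia.
have iN := Nw; rewrite -index_mem size_word in iN; set i := (index N w).+1.
have lN : letter w i = N by rewrite /letter /= nth_index.
have le_N j : letter w j <= N.
  case: j => // j; rewrite /letter /=; have [jN | jN] := ltnP j N.
    have := mem_nth 0 (s := w) (n := j); rewrite size_word => /(_ jN).
    by rewrite (perm_mem (perm_word s)) mem_iota add1n ltnS => /andP[].
  by rewrite nth_default ?size_word.
have iP : 0 < i <= N by [].
have pk : peak w i.
  have := letter_neq_next iP; have := letter_neq_prev iP.
  by rewrite /peak lN !ltn_neqAle !le_N !andbT eq_sym => -> ; rewrite eq_sym.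
have big_all r : subseq r w -> N \notin r -> all (ltn^~ N) r.
  move=> rw Nr; apply/allP=> y yr; have := mem_subseq rw yr.
  rewrite (perm_mem (perm_word s)) mem_iota add1n ltnS => /andP[_ yN].
  by rewrite /= ltn_neqAle yN andbT; apply: contraNneq Nr => <-.
have ed : drop i.-1 w = N :: drop i w.
  by rewrite (drop_nth 0) ?size_word //; congr (_ :: _); exact: lN.
have uw : uniq w by rewrite (perm_uniq (perm_word s)) iota_uniq.
move: uw; rewrite -[X in uniq X](cat_take_drop i.-1) ed.
rewrite cat_uniq /= negb_or => /and3P[_ /andP[NL _] /andP[NR _]].
split; rewrite -has_count; apply/hasP; exists i; rewrite ?mem_positions //= pk andbT.
  by rewrite /is_lmax lN big_all // take_subseq.
by rewrite /is_rmax lN big_all // drop_subseq.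
Qed.

End WordStats.

(** * Weight of a permutation word *)

Section WordWeight.
Local Open Scope ring_scope.
Variables (R : comNzRingType) (P Q : nat -> R) (ql qr t : R) (ord : rel nat).

Lemma context_weight_prod l z r :
  context_weight P Q ql qr t ord l z r =
  \prod_(0 <= i < size z)
    letter_weight P Q ql qr t ord (rev (take i z) ++ l) (nth 0%N z i) (drop i.+1 z ++ r).
Proof.
elim: z l => [|y z IH] l; first by rewrite big_geq.
rewrite /= big_nat_recl //= IH drop0; congr (_ * _); apply: eq_bigr => i _.
by rewrite rev_cons cat_rcons.
Qed.

Lemma prod_exp (b : pred nat) (x : R) r : \prod_(i <- r) x ^+ b i = x ^+ count b r.
Proof. by elim: r => [|i r IH]; rewrite ?big_nil // big_cons IH /= exprD. Qed.

Lemma prod_bool (b : pred nat) r : \prod_(i <- r) (b i)%:R = (all b r)%:R :> R.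
Proof.
elim: r => [|i r IH]; first by rewrite big_nil.
by rewrite big_cons IH /= -natrM mulnb.
Qed.

Lemma state_weight_word N (s : 'S_N) (w := word s) :
  state_weight P Q ql qr t ord [:: w] =
  (\prod_(y <- Pk w) P y) * (\prod_(y <- Val w) Q y)
  * ql ^+ lmaxpk w * qr ^+ rmaxpk w * t ^+ lmaxda w
  * ((dd w == 0%N) &&
     all (fun i => valley w i ==> ord (left_max s i) (right_max s i)) (positions w))%:R.
Proof.
have -> : state_weight P Q ql qr t ord [:: w] =
    context_weight P Q ql qr t ord [::] w [::].
  rewrite /state_weight /zsuffix /= cats0 -cats1 context_weight_cat /=.
  rewrite context_weight_cat /= /letter_weight /= !mulr1 mul1r.
  apply: eq_context_weight => y _ y0.
  have v : same_view y [:: 0%N] [::] by split; rewrite /= ?y0 // prefix_above_cons ltn0.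
  by split.
rewrite context_weight_prod /dd -leqn0 leqNgt -has_count -all_predC -all_predI.
rewrite -prod_bool -!prod_exp !big_map !big_filter !(big_mkcond (peak w)).
rewrite !(big_mkcond (valley w)) -!big_split /=.
rewrite [in RHS]/positions -[iota 1 _]/(iota (1 + 0)%N _) iotaDl big_map.
rewrite /index_iota subn0 !big_seq; apply: eq_bigr => j.
rewrite mem_iota /= size_word => jN; rewrite !cats0 add1n.
have iN : (0 < j.+1 <= N)%N by [].
rewrite /letter_weight -/(letter w j.+1) (gtn_eqF (letter_gt0 s iN)).
have := head_rev_take s iN; rewrite [j.+1.-1]/= => ->; rewrite head_drop.
rewrite /is_lmax /is_rmax [j.+1.-1]/= all_rev /left_max /right_max /= -/w.
rewrite /peak /valley /dascent /ddescent /=.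
have := letter_neq_next s iN; have := letter_neq_prev s iN; rewrite -/w /=.
case: (ltngtP (letter w j.+1) (letter w j)) => // lp _;
  case: (ltngtP (letter w j.+1) (letter w j.+2)) => // ln _ /=;
  rewrite ?andbT ?andbF ?expr0 ?mul1r ?mulr1 ?mulr0 //.
Qed.

End WordWeight.

(** * Specialization to the polynomial weights *)

Section PolynomialWeights.
Local Open Scope ring_scope.

(** Words of permutations are distinct arrangements of 1, ..., [N], and there are
    as many of them as arrangements. *)
Lemma sum_permutations_word (R : comNzRingType) N (F : seq nat -> R) :
  \sum_(w <- permutations (iota 1 N)) F w = \sum_(s : 'S_N) F (word s).
Proof.
rewrite -(big_map (@word N) xpredT F); apply/esym/perm_big.
have word_inj : injective (@word N).
  move=> s s' es; apply/permP => i; apply/val_inj => /=.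
  have := congr1 (fun w => nth 0%N w i) es.
  by rewrite !(nth_map i) -?enumT ?size_enum_ord // nth_ord_enum => -[].
have uw : uniq [seq word s | s <- index_enum ('S_N : finType)].
  by rewrite map_inj_uniq // /index_enum -enumT enum_uniq.
have [] // := uniq_min_size uw (s2 := permutations (iota 1 N)) _ _.
- by move=> _ /mapP[s _ ->]; rewrite mem_permutations perm_word.
- rewrite size_permutations ?iota_uniq // size_iota size_map.
  by rewrite /index_enum -enumT -cardE card_Sn.
by move=> _ ew; apply: uniq_perm; rewrite ?permutations_uniq.
Qed.

(** Replacing each valley [y] by [N - y] shifts D by [N] times the number of
    valleys, and avoids negative powers of h. *)
Lemma sum_Pk_Val N (s : 'S_N) (w := word s) :
  (\sum_(y <- Pk w | y != N) y + \sum_(y <- Val w) (N - y)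
   = Dstat w + N * size (Val w))%N.
Proof.
have -> : (Dstat w = \sum_(y <- Pk w | y != N) y - \sum_(y <- Val w) y)%N.
  by rewrite /Dstat size_word.
have le_N y : y \in Val w -> (y <= N)%N.
  case/mapP=> i _ ->; case: i => // i; rewrite /letter /=.
  have [iN | iN] := ltnP i N; last by rewrite nth_default ?size_word.
  have := mem_nth 0%N (s := w) (n := i); rewrite size_word => /(_ iN).
  by rewrite (perm_mem (perm_word s)) mem_iota add1n ltnS => /andP[].
have comp r : {in r, forall y, y <= N}%N ->
    (\sum_(y <- r) (N - y) + \sum_(y <- r) y = N * size r)%N.
  elim: r => [|y r IH] rN; first by rewrite !big_nil muln0.
  have := IH (fun z zr => rN z (mem_behead (s := y :: r) zr)).
  by have := rN y (mem_head y r); rewrite !big_cons /= mulnS; lia.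
by rewrite -(comp _ le_N) [RHS]addnCA subnK ?sum_Val_le_Pk // addnC.
Qed.

(** The polynomial variable counts valleys. *)
Definition peak_var N y : {poly {mpoly rat[4]}} := if y == N then 1 else (h ^+ y)%:P.
Definition valley_var N y : {poly {mpoly rat[4]}} := 'X * (h ^+ (N - y))%:P.

Lemma prod_word_vars N (s : 'S_N) (w := word s) c :
  (\prod_(y <- Pk w) peak_var N y) * (\prod_(y <- Val w) (c%:P * valley_var N y)) =
  (c ^+ size (Val w) * h ^+ (Dstat w + N * size (Val w)))%:P * 'X^(size (Val w)).
Proof.
rewrite -sum_Pk_Val -/w exprD.
have -> : \prod_(y <- Pk w) peak_var N y = (h ^+ (\sum_(y <- Pk w | y != N) y))%:P.
  elim: (Pk w) => [|y r IH]; first by rewrite !big_nil.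
  rewrite !big_cons IH /peak_var; case: eqP => _ /=; first by rewrite mul1r.
  by rewrite exprD polyCM.
have -> : \prod_(y <- Val w) (c%:P * valley_var N y) =
    (c ^+ size (Val w) * h ^+ (\sum_(y <- Val w) (N - y)))%:P * 'X^(size (Val w)).
  elim: (Val w) => [|y r IH]; first by rewrite !big_nil !mulr1.
  by rewrite !big_cons IH /valley_var /= exprD !exprS !polyCM; ring.
by rewrite !polyCM; ring.
Qed.

Definition pk_var : {mpoly rat[4]} := f * alpha.
Definition da_var : {mpoly rat[4]} := t * alpha.

(** Splits the weight of a permutation into the summand of E and a factor due to
    the letter [N], a peak and a maximum from both sides, and to the shift of D. *)
Lemma monomial_two_sided (R : comNzRingType) (u v w a z : R) d m i j l :
  v ^+ (d + m) * z * (u * a) ^+ i.+1 * (u * a) ^+ j.+1 * (w * a) ^+ l * 1 =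
  (u * a) ^+ 2 * v ^+ m * (u ^+ (i + j) * v ^+ d * w ^+ l * a ^+ (i + l + j)) * z.
Proof. by rewrite !(exprD, exprS, exprMn); ring. Qed.

Lemma monomial_one_sided (R : comNzRingType) (u v w a z b : R) d m i j l :
  b * v ^+ (d + m) * z * (u * a) ^+ i.+1 * 1 ^+ j * (w * a) ^+ l * 1 =
  u * a * v ^+ m * b * (u ^+ i * v ^+ d * w ^+ l * a ^+ (i + l)) * z.
Proof. by rewrite expr1n !(exprD, exprS, exprMn); ring. Qed.

Lemma weight_two_sided N (s : 'S_N) (w := word s) : (0 < N)%N ->
  state_weight (peak_var N) (valley_var N) pk_var%:P pk_var%:P da_var%:P
    (fun _ _ => true) [:: w] =
  (if dd w == 0%N then pk_var ^+ 2 * h ^+ (N * size (Val w))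
     * (f ^+ (lmaxpk w + rmaxpk w - 2) * h ^+ Dstat w * t ^+ lmaxda w
        * alpha ^+ (lmax w + rmax w - 2)) else 0)%:P * 'X^(size (Val w)).
Proof.
move=> N0; rewrite state_weight_word -/w.
have -> : \prod_(y <- Val w) valley_var N y = \prod_(y <- Val w) (1%:P * valley_var N y).
  by apply: eq_bigr => y _; rewrite mul1r.
rewrite prod_word_vars -/w expr1n mul1r.
rewrite (@eq_all _ _ xpredT) ?all_predT ?andbT => [|i]; last by rewrite implybT.
have [dd0 | _] := eqVneq (dd w) 0%N; last by rewrite mulr0 mul0r.
rewrite lmaxE rmaxE ?dd0 //; have [] := max_is_peak s N0; rewrite -/w.
case: (lmaxpk w) => // a _; case: (rmaxpk w) => // b _.
rewrite addSn addnS subn2 /= addSn addnS subn2 /= /pk_var /da_var.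
rewrite !(polyCM, polyC_exp); exact: monomial_two_sided.
Qed.

Lemma weight_one_sided N (s : 'S_N) (w := word s) : (0 < N)%N ->
  state_weight (peak_var N) (fun y => 2 * valley_var N y) pk_var%:P 1 da_var%:P
    ltn [:: w] =
  (if andre1 w then pk_var * h ^+ (N * size (Val w)) * 2 ^+ size (Val w)
     * (f ^+ (lmaxpk w - 1) * h ^+ Dstat w * t ^+ lmaxda w
        * alpha ^+ (lmax w - 1)) else 0)%:P * 'X^(size (Val w)).
Proof.
move=> N0; rewrite state_weight_word -/w -andre1E.
have -> : 2 = (2%:R : {mpoly rat[4]})%:P :> {poly {mpoly rat[4]}}.
  by rewrite rmorph_nat.
rewrite prod_word_vars -/w; case: ifP => _; last by rewrite mulr0 mul0r.
rewrite lmaxE; have [] := max_is_peak s N0; rewrite -/w.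
case: (lmaxpk w) => // a _ _.
rewrite addSn !subn1 /= /pk_var /da_var.
rewrite !(polyCM, polyC_exp); exact: monomial_one_sided.
Qed.

Lemma var_neq0 (i : 'I_4) : ('X_i : {mpoly rat[4]}) != 0.
Proof.
apply/eqP => /(congr1 (mcoeff U_(i))); rewrite mcoeffXU eqxx mcoeff0.
by move/eqP; rewrite oner_eq0.
Qed.

Lemma coef_sum_monomials (R : nzRingType) (I : finType) (a : I -> R) (m : I -> nat) k :
  (\sum_i (a i)%:P * 'X^(m i))`_k = \sum_i (if m i == k then a i else 0).
Proof.
rewrite coef_sum; apply: eq_bigr => i _.
by rewrite coefCM coefXn eq_sym; case: eqP => _; rewrite ?mulr1 ?mulr0.
Qed.

End PolynomialWeights.

Local Open Scope ring_scope.

Theorem theorem5p9 (n k : nat) (hk : (k <= n./2)%N) :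
  E n k =
  \sum_(s : 'S_n.+1 | andre1 (word s) && (des (word s) == k))
    (f ^+ (lmaxpk (word s) - 1) * h ^+ Dstat (word s)
     * t ^+ lmaxda (word s) * alpha ^+ (lmax (word s) - 1)).
Proof.
pose valleys (s : 'S_n.+1) := size (Val (word s)).
pose term2 (s : 'S_n.+1) :=
  f ^+ (lmaxpk (word s) + rmaxpk (word s) - 2) * h ^+ Dstat (word s)
  * t ^+ lmaxda (word s) * alpha ^+ (lmax (word s) + rmax (word s) - 2).
pose term1 (s : 'S_n.+1) :=
  f ^+ (lmaxpk (word s) - 1) * h ^+ Dstat (word s)
  * t ^+ lmaxda (word s) * alpha ^+ (lmax (word s) - 1).
(* The coefficients of the two sums as polynomials in the valley variable. *)
pose coef2 s := if dd (word s) == 0%N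
  then pk_var ^+ 2 * h ^+ (n.+1 * valleys s) * term2 s else 0.
pose coef1 s := if andre1 (word s)
  then pk_var * h ^+ (n.+1 * valleys s) * 2 ^+ valleys s * term1 s else 0.
have sums : \sum_s (coef2 s)%:P * 'X^(valleys s) =
    pk_var%:P * \sum_s (coef1 s)%:P * 'X^(valleys s).
  have := @sum_two_sided_one_sided _ (peak_var n.+1) (valley_var n.+1)
    pk_var%:P da_var%:P n.+1 isT.
  rewrite !sum_permutations_word.
  under eq_bigr => s _ do rewrite weight_two_sided //.
  by under [X in _ * X]eq_bigr => s _ do rewrite weight_one_sided //.
have {}sums : \sum_s (if valleys s == k then coef2 s else 0) =
    pk_var * \sum_s (if valleys s == k then coef1 s else 0).
  have coef_sums := congr1 (fun p : {poly {mpoly rat[4]}} => p`_k) sums.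
  apply: etrans (esym (coef_sum_monomials coef2 valleys k)) _.
  apply: etrans coef_sums _; apply: etrans (coefCM _ _ _) _.
  by congr (_ * _); apply: coef_sum_monomials.
(* N is a maximum and a peak from both sides, and each of the k valleys y has
   been counted as N - y in the exponent of h. *)
pose c := pk_var ^+ 2 * h ^+ (n.+1 * k).
have c0 : c != 0.
  by rewrite /c /pk_var !(mulf_neq0, expf_neq0) // var_neq0.
pose SE := \sum_(s | (dd (word s) == 0%N) && (des (word s) == k)) term2 s.
pose SA := \sum_(s | andre1 (word s) && (des (word s) == k)) term1 s.
have {}sums : c * SE = c * (2 ^+ k * SA).
  transitivity (\sum_s (if valleys s == k then coef2 s else 0)).
    rewrite mulr_sumr [LHS]big_mkcond; apply: eq_bigr => s _.
    rewrite desE -/(valleys s) /coef2; have [dd0|_] := eqVneq (dd (word s)) 0%N.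
      by rewrite dd0 addn0 /=; case: eqP => [->|].
    by rewrite if_same.
  rewrite {}sums /c !mulr_sumr [RHS]big_mkcond; apply: eq_bigr => s _.
  rewrite desE -/(valleys s) /coef1.
  have [An|An] := boolP (andre1 (word s)); last by rewrite if_same mulr0.
  have /eqP -> : dd (word s) == 0%N by case/andP: An.
  rewrite addn0 /=; case: eqP => [->|_]; last by rewrite mulr0.
  by rewrite expr2 !mulrA.
rewrite -/SA /E -/SE (mulfI c0 sums).
have -> : 2 ^+ k = (2 ^ k)%N%:R :> {mpoly rat[4]} by rewrite natrX.
by rewrite mulr_natl -scaler_nat scalerA natrX mulVf ?scale1r // expf_neq0.
Qed.
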